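(* Let $n\ge 2$ and let $\|\cdot\|$ be a norm on $\mathbb{R}^n$. Then there is a constant $C$, depending only on the norm $\|\cdot\|$, such that for every $\delta\ge 0$ and every nonempty set $A\subset\mathbb{R}^n$ satisfying $$a_0,a_1\in A \implies \operatorname{dist}\Bigl(\frac{a_0+a_1}{2},A\Bigr)\le\delta,$$ one has $$z\in\operatorname{Co}(A)\implies \operatorname{dist}(z,A)\le C\,\delta .$$ Moreover, if $C_{\|\cdot\|}$ denotes the sharp (that is, the smallest) such constant, then $$[\log_2(n-1)]+1+\frac{n-1}{2^{[\log_2(n-1)]}}\ \le\ C_{\|\cdot\|}\ \le\ [\log_2(n)]+1+\frac{n}{2^{[\log_2(n)]}},$$ and when $\|\cdot\|$ is the Euclidean norm, $$C_{\|\cdot\|}=[\log_2(n-1)]+1+\frac{n-1}{2^{[\log_2(n-1)]}}.$$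
   Context: $\operatorname{Co}(A)$ is the convex hull of $A$, $\operatorname{dist}(x,A)=\inf\{\|x-a\|:a\in A\}$ is the distance in the given norm, and $[\,\cdot\,]$ is the greatest integer function (floor). *)

(* Defs.v *)
From HB Require Import structures.
From mathcomp Require Import all_boot all_order all_algebra.
From mathcomp Require Import all_classical all_reals all_analysis.

Set Implicit Arguments.
Unset Strict Implicit.
Unset Printing Implicit Defensive.

Import Order.TTheory GRing.Theory Num.Theory.
Local Open Scope classical_set_scope.
Local Open Scope ring_scope.

(* The norm is a plain function on row vectors, because 'rV[R]_n already
   carries the canonical sup norm as `|x|.  Nonnegativity and N 0 = 0 follow
   from the three axioms. *)
Record is_norm (R : realType) (n : nat) (N : 'rV[R]_n -> R) : Prop := IsNorm {
  is_norm_triangle : forall x y, N (x + y) <= N x + N y;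
  is_norm_homog : forall (c : R) x, N (c *: x) = `|c| * N x;
  is_norm_eq0 : forall x, N x = 0 -> x = 0
}.

Definition euclidean_norm (R : realType) (n : nat) (x : 'rV[R]_n) : R :=
  Num.sqrt (\sum_(i < n) x ord0 i ^+ 2).

Definition convex_hull (R : realType) (n : nat) (A : set 'rV[R]_n) :
    set 'rV[R]_n :=
  smallest (@convex_set R 'rV[R]_n) A.

(* inf is the real infimum, only meaningful here for nonempty A. *)
Definition dist (R : realType) (n : nat) (N : 'rV[R]_n -> R)
    (x : 'rV[R]_n) (A : set 'rV[R]_n) : R :=
  inf [set N (x - a) | a in A].

Definition approx_midconvex (R : realType) (n : nat) (N : 'rV[R]_n -> R)
    (delta : R) (A : set 'rV[R]_n) : Prop :=
  forall a0 a1, A a0 -> A a1 -> dist N (2^-1 *: (a0 + a1)) A <= delta.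

Definition stability_constants (R : realType) (n : nat)
    (N : 'rV[R]_n -> R) : set R :=
  [set C | forall (delta : R) (A : set 'rV[R]_n),
     0 <= delta -> A !=set0 -> approx_midconvex N delta A ->
     forall z, convex_hull A z -> dist N z A <= C * delta].

Definition is_smallest (R : realType) (E : set R) (c : R) : Prop :=
  E c /\ lbound E c.

Definition floor_log2 (R : realType) (m : nat) : int :=
  Num.floor (ln (m%:R : R) / ln 2).

(* The power has an integer exponent, floor_log2 R m. *)
Definition log_bound (R : realType) (m : nat) : R :=
  (floor_log2 R m)%:~R + 1 + m%:R / 2 ^ floor_log2 R m.

(* Main.v *)
Require Import Defs.
From mathcomp Require Import all_boot all_order all_algebra.
From mathcomp Require Import all_classical all_reals all_analysis.
From mathcomp Require Import ring lra zify.
Import Order.TTheory GRing.Theory Num.Theory.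
Import numFieldNormedType.Exports.
Local Open Scope classical_set_scope.
Local Open Scope ring_scope.
Set Implicit Arguments.
Unset Strict Implicit.
Unset Printing Implicit Defensive.

(** Write [kappa(m)] for [log_bound R m] and [f(x)] for the distance of [x] to
    the approximately midconvex set [A].  By the triangle inequality [f]
    satisfies [f((x+y)/2) <= (f x + f y)/2 + delta], and [f = 0] on [A].

    The constant comes from the Knuth-Yao theorem on generating a random
    variable with fair coin flips.  A convex combination [z] of [p+1] points of
    [A] with weights [x_i] is the root of a binary tree of midpoints whose
    leaves lie in [A]; every inner node at level [k] costs [delta/2^k].
    The cheapest tree has [t_k = sum_i frac(2^k x_i)] inner nodes at level [k], an integer
    that is at most [2^k] and at most [p].  Hence
    [f(z) <= delta * sum_k min(2^k, p)/2^k], and this series sums to [kappa(p)]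
    (knuth_yao_sum, combination_dist_le).  Together with Caratheodory's theorem,
    which gives [p = n], this is the upper bound for every norm.

    For the lower bound, the tree cost [g(x) = sum_i sum_k frac(2^k x_i)/2^k],
    truncated at level [K], satisfies [g((x+y)/2) <= (g x + g y)/2 + 1] because
    [frac] is subadditive, it vanishes at the vertices of the simplex, and it is
    at least [sum_(k<K) min(2^k,p)/2^k] on a nonempty open set of weights.  Draw
    the epigraph of [g] over a simplex with [n] vertices in a hyperplane of
    [R^n], with heights measured along a unit vector [e] such that every point
    at height [t] has norm at least [|t|].  The epigraph is approximately
    midconvex with [delta = 1], and its convex hull contains the base of the
    graph.  Once the simplex is large, a base point below the open set can only
    be close to points above the open set, which are too high
    (log_bound_le_constant).

    In the Euclidean case, let [z] maximize [f] on a simplex with [n+1] vertices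
    in [A].  If [z] is a combination of [n] points of [A] the first argument
    gives [kappa(n-1)].  Otherwise [z] is an interior point, so a local maximum
    of [f], and the points of [A] nearly at the distance [r = f(z)] surround
    [z].  If [r] exceeded [delta * kappa(n-1)], midpoints of two such points
    would have to stay far from [z], hence two such points would be seen from
    [z] under an angle that is not very obtuse.  A greedy choice then produces
    [n+1] nearly orthogonal vectors in [R^n], which is impossible (local_max_dist_le).

    The set of stability constants is nonempty, bounded below and closed, so
    that its infimum is its least element. *)

(** * The series of min(2^k, p)/2^k and its sum *)

(** The largest expected number of inner nodes met in the first [K] levels by a
    fair random walk down a binary tree with at most [p] inner nodes per level.
*)
Definition knuth_yao_sum (R : realType) (p K : nat) : R :=
  \sum_(k < K) (minn (2 ^ k) p)%:R / 2 ^+ k.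

Lemma knuth_yao_sumS (R : realType) (p K : nat) :
  knuth_yao_sum R p K.+1 = knuth_yao_sum R p K + (minn (2 ^ K) p)%:R / 2 ^+ K.
Proof. by rewrite /knuth_yao_sum big_ord_recr. Qed.

Lemma knuth_yao_sum_mono (R : realType) (p K j : nat) :
  knuth_yao_sum R p K <= knuth_yao_sum R p (K + j).
Proof.
elim: j => [|j IH]; first by rewrite addn0.
rewrite addnS knuth_yao_sumS (le_trans IH)// lerDl.
by rewrite divr_ge0// exprn_ge0.
Qed.

Lemma floor_log2E (R : realType) (m : nat) : (0 < m)%N ->
  floor_log2 R m = (trunc_log 2 m)%:Z.
Proof.
move=> m0; have /andP[lo hi] := trunc_log_bounds (isT : (1 < 2)%N) m0.
have ln2 : 0 < ln (2 : R) by rewrite ln_gt0// ltr1n.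
have pow k : k%:R * ln (2 : R) = ln (2 ^+ k) by rewrite lnXn// mulr_natl.
apply: floor_def; rewrite -(PoszD _ 1) addn1 -!pmulrn.
rewrite ler_pdivlMr// ltr_pdivrMr// !pow.
rewrite ler_ln ?ltr_ln ?posrE ?exprn_gt0 ?ltr0n//.
by rewrite -!natrX ler_nat ltr_nat lo hi.
Qed.

Lemma log_boundE (R : realType) (m : nat) : (0 < m)%N ->
  log_bound R m = (trunc_log 2 m).+1%:R + m%:R / 2 ^+ trunc_log 2 m.
Proof. by move=> m0; rewrite /log_bound floor_log2E// -pmulrn natr1. Qed.

(** Up to level [log2 p] every term is 1; from then on the terms form a
    geometric series [p/2^k], whose remainder is explicit. *)
Lemma knuth_yao_sum_tail (R : realType) (p j : nat) : (0 < p)%N ->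
  knuth_yao_sum R p ((trunc_log 2 p).+1 + j) =
  log_bound R p - p%:R / 2 ^+ (trunc_log 2 p + j).
Proof.
move=> p0; have /andP[lo hi] := trunc_log_bounds (isT : (1 < 2)%N) p0.
rewrite log_boundE//; set L := trunc_log 2 p in lo hi *.
elim: j => [|j IH].
  rewrite !addn0 addrK /knuth_yao_sum (eq_bigr (fun=> 1)) => [|i _].
    by rewrite sumr_const card_ord.
  have /minn_idPl -> : (2 ^ i <= p)%N.
    by rewrite (leq_trans _ lo)// leq_pexp2l// -ltnS.
  by rewrite natrX divff// expf_neq0.
rewrite addnS knuth_yao_sumS IH addnS.
have /minn_idPr -> : (p <= 2 ^ (L.+1 + j))%N.
  by rewrite (leq_trans (ltnW hi))// leq_pexp2l// leq_addr.
by rewrite addSn !exprS; field; rewrite !expf_neq0.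
Qed.

Lemma knuth_yao_sum_le (R : realType) (p K : nat) : (0 < p)%N ->
  knuth_yao_sum R p K <= log_bound R p.
Proof.
move=> p0; apply: le_trans (knuth_yao_sum_mono _ _ _ (trunc_log 2 p).+1) _.
by rewrite addnC knuth_yao_sum_tail// gerBl divr_ge0// exprn_ge0.
Qed.

Lemma half_power_small (R : realType) (M e : R) : 0 < e ->
  exists K0, forall K, (K0 <= K)%N -> M / 2 ^+ K < e.
Proof.
move=> e0; exists (Num.truncn (`|M| / e)).+1 => K hK.
rewrite ltr_pdivrMr ?exprn_gt0// -ltr_pdivrMl// mulrC.
apply: le_lt_trans (_ : `|M| / e < _).
  by rewrite ler_wpM2r// ?invr_ge0 ?(ltW e0)// ler_norm.
apply: lt_le_trans (truncnS_gt _) _.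
by rewrite -natrX ler_nat (leq_trans hK)// ltnW// ltn_expl.
Qed.

Lemma log_bound_approx (R : realType) (p : nat) (e : R) : (0 < p)%N -> 0 < e ->
  exists K, log_bound R p - e < knuth_yao_sum R p K.
Proof.
move=> p0 e0; have [K0 hK] := half_power_small p%:R e0.
exists ((trunc_log 2 p).+1 + K0)%N; rewrite knuth_yao_sum_tail//.
by rewrite ltrD2l ltrN2 hK// leq_addl.
Qed.

(** * Approximately midconvex functions on a simplex *)

Definition approx_midconvex_fun (R : realType) (V : lmodType R) (d : R)
    (f : V -> R) : Prop :=
  forall x y, f (2^-1 *: (x + y)) <= (f x + f y) / 2 + d.

(** One level of the midpoint tree: joining the nodes two by two costs [d] per
    new node. *)
Lemma pairing (R : realType) (V : lmodType R) (d : R) (f : V -> R)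
    (t : nat) (s : seq V) :
  approx_midconvex_fun d f -> size s = t.*2 ->
  exists s' : seq V,
    [/\ size s' = t,
        \sum_(b <- s') b = 2^-1 *: \sum_(b <- s) b
      & \sum_(b <- s') f b <= (\sum_(b <- s) f b) / 2 + d *+ t].
Proof.
move=> fmid; elim: t s => [|t IH] [|x [|y s]] //=.
  by move=> _; exists [::]; rewrite !big_nil scaler0 mul0r mulr0n addr0.
rewrite doubleS => -[/IH[s' [szs' sums' fs']]].
exists (2^-1 *: (x + y) :: s'); rewrite /= szs' !big_cons sums'; split=> //.
  by rewrite -scalerDr addrA.
by have := fmid x y; move: fs'; rewrite (mulrS d); move: (d *+ t) => u; lra.
Qed.

(** Equal leaves are paired for free, which leaves one unpaired copy of each
    point of odd multiplicity. *)
Lemma sum_odd_half (R : realType) (V : lmodType R) (I : finType) (a : I -> V)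
    (c : I -> nat) :
  \sum_i a i *+ c i =
  \sum_(x <- [seq a i | i <- enum I & odd (c i)]) x +
  2 *: \sum_i a i *+ (c i)./2.
Proof.
rewrite big_map big_filter big_enum_cond /= scaler_sumr [X in X + _]big_mkcond.
rewrite -big_split/=; apply: eq_bigr => i _.
rewrite scaler_nat -mulrnA muln2 -[in LHS](odd_double_half (c i)) mulrnDr.
by case: odd.
Qed.

(** The tree is built from its bottom level [K] upwards.  There are [c i] leaves
    equal to [a i], and the list [s] collects the nodes that are already joined.
    The invariant [size s <= p] survives a level: at most [p+1] leaves have odd
    multiplicity, so at most [2p+1] nodes are joined, which makes at most [p]
    pairs. *)
Lemma dyadic_combination_bound (R : realType) (V : lmodType R) (d : R)
    (f : V -> R) (p : nat) (a : 'I_p.+1 -> V) :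
  0 <= d -> approx_midconvex_fun d f -> (forall i, f (a i) <= 0) ->
  forall (K : nat) (c : 'I_p.+1 -> nat) (s : seq V),
  (size s <= p)%N -> (\sum_i c i + size s = 2 ^ K)%N ->
  f ((2 ^+ K)^-1 *: (\sum_i a i *+ c i + \sum_(b <- s) b)) <=
  (\sum_(b <- s) f b) / 2 ^+ K + d * knuth_yao_sum R p K.
Proof.
move=> d0 fmid fa0; elim=> [|K IH] c s szs sumc.
  (* The root is a single node, either a leaf or the only element of [s]. *)
  rewrite /knuth_yao_sum big_ord0 mulr0 addr0 expr0 invr1 scale1r mulr1.
  case: s szs sumc => [|b [|b' s]] _.
  - rewrite addn0 !big_nil addr0 => sumc.
    have [i ci] : exists i, c i != 0%N.
      apply/existsP; apply: contraPT sumc; rewrite negb_exists => /forallP h.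
      by rewrite big1// => i _; apply/eqP; have := h i; rewrite negbK.
    move: sumc; rewrite (bigD1 i)//= expn0; set r := (\sum_(j | _) _)%N => sumc.
    have ci1 : c i = 1%N by lia.
    rewrite (bigD1 i)//= ci1 mulr1n big1 ?addr0// => j ji.
    have : r == 0%N by apply/eqP; lia.
    by rewrite sum_nat_eq0 => /forall_inP/(_ j ji)/eqP ->.
  - rewrite !big_seq1 /= => sumc.
    rewrite big1 ?add0r// => i _.
    move: sumc; rewrite addn1 expn0 => -[/eqP].
    by rewrite sum_nat_eq0 => /forall_inP/(_ i isT)/eqP ->.
  - by rewrite /= expn0 !addnS.
set odds := [seq a i | i <- enum 'I_p.+1 & odd (c i)].
have szo : size odds = (\sum_i odd (c i))%N.
  by rewrite size_map size_filter -sum1_count big_enum_cond -big_mkcond.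
have szo_le : (size odds <= p.+1)%N.
  by rewrite szo -[leqRHS]card_ord -sum1_card leq_sum// => i _; case: odd.
have sumc2 : (\sum_i c i = size odds + (\sum_i (c i)./2).*2)%N.
  rewrite szo -muln2 big_distrl -big_split /=; apply: eq_bigr => i _.
  by rewrite muln2 odd_double_half.
have evn : odd (size (odds ++ s)) = false.
  have := congr1 odd sumc; rewrite sumc2 expnS mul2n odd_double size_cat.
  by rewrite addnAC oddD odd_double addbF.
have [s' [szs' sums' fs']] :=
  pairing fmid (esym (even_halfK (negbT evn)) : size (odds ++ s) = _).
set t := (size (odds ++ s))./2 in szs' fs'.
have szt : (size odds + size s = t.*2)%N.
  by rewrite /t even_halfK ?evn// size_cat.
have tp : (size s' <= p)%N by rewrite szs'; lia.
have sumc' : (\sum_i (c i)./2 + size s' = 2 ^ K)%N.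
  by rewrite szs'; move: sumc; rewrite sumc2 expnS; lia.
have {IH} := IH _ _ tp sumc'.
rewrite sums' big_cat /= (sum_odd_half a c) -/odds knuth_yao_sumS.
have -> : (2 ^+ K)^-1 *: (\sum_i a i *+ (c i)./2 +
      2^-1 *: (\sum_(i <- odds) i + \sum_(i <- s) i)) =
    (2 ^+ K.+1)^-1 *: (\sum_(x <- odds) x + 2 *: (\sum_i a i *+ (c i)./2) +
      \sum_(b <- s) b).
  rewrite exprS invfM mulrC -scalerA; congr (_ *: _).
  rewrite addrAC [in RHS]scalerDr scalerA mulVf ?pnatr_eq0// scale1r.
  exact: addrC.
move=> /le_trans; apply.
have fo : \sum_(b <- odds) f b <= 0.
  by rewrite big_map sumr_le0.
have tmin : d *+ t <= d * (minn (2 ^ K) p)%:R.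
  by rewrite -(mulr_natr d) ler_wpM2l// ler_nat -szs'; lia.
rewrite big_cat/= in fs'.
have key : \sum_(b <- s') f b <=
    (\sum_(b <- s) f b) / 2 + d * (minn (2 ^ K) p)%:R.
  apply: (le_trans fs'); apply: lerD tmin.
  by rewrite ler_wpM2r ?invr_ge0// gerDr.
have w0 : 0 <= (2 ^+ K : R)^-1 by rewrite invr_ge0 exprn_ge0.
rewrite exprS invfM mulrDr addrA addrAC lerD2r.
rewrite (mulrA _ 2^-1) (mulrA d) -mulrDl.
exact: ler_wpM2r.
Qed.

(** Weights that are not dyadic are cut at level [K].  The bits of [x i] beyond
    level [K] are put together into [t <= p] copies of a single point [b] of the
    hull.  As [f] is bounded on the hull, these nodes contribute [O(2^-K)], and
    [K] is arbitrary. *)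
Lemma hull_bound (R : realType) (V : lmodType R) (d B : R)
    (f : V -> R) (p : nat) (a : 'I_p.+1 -> V) :
  (0 < p)%N -> 0 <= d -> approx_midconvex_fun d f -> (forall i, f (a i) <= 0) ->
  (forall y : 'I_p.+1 -> R, (forall i, 0 <= y i) -> \sum_i y i = 1 ->
    f (\sum_i y i *: a i) <= B) ->
  forall x : 'I_p.+1 -> R, (forall i, 0 <= x i) -> \sum_i x i = 1 ->
  f (\sum_i x i *: a i) <= d * log_bound R p.
Proof.
move=> p0 d0 fmid fa0 fB x x0 x1; rewrite leNgt; apply/negP => gap.
rewrite -subr_gt0 in gap.
have [K /(_ K (leqnn K))] := half_power_small (p%:R * `|B|) gap.
apply/negP; rewrite -leNgt.
pose c i := Num.truncn (2 ^+ K * x i).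
pose e i := 2 ^+ K * x i - (c i)%:R.
have kx0 i : 0 <= 2 ^+ K * x i by rewrite mulr_ge0// exprn_ge0.
have e0 i : 0 <= e i by rewrite subr_ge0 truncn_le.
have e1 i : e i < 1 by rewrite ltrBlDl natr1 truncnS_gt.
have sume : \sum_i e i = 2 ^+ K - (\sum_i c i)%:R.
  by rewrite sumrB -mulr_sumr x1 mulr1 natr_sum.
have cK : (\sum_i c i <= 2 ^ K)%N.
  by rewrite -(ler_nat R) natrX -subr_ge0 -sume sumr_ge0.
pose t := (2 ^ K - \sum_i c i)%N.
have sumet : \sum_i e i = t%:R by rewrite sume natrB// natrX.
have tp : (t <= p)%N.
  rewrite -ltnS -(ltr_nat R) -sumet.
  apply: lt_le_trans (_ : \sum_(i < p.+1) (1 : R) <= _); last first.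
    by rewrite sumr_const card_ord.
  by apply: ltr_sum => //; apply/hasP; exists ord0; rewrite ?mem_index_enum.
pose b := t%:R^-1 *: \sum_i e i *: a i.
have tb : \sum_(y <- nseq t b) y = \sum_i e i *: a i.
  rewrite big_nseq iter_addr addr0 /b.
  have [t0|t0] := eqVneq t 0%N.
    rewrite t0 mulr0n big1// => i _; apply/eqP; rewrite scaler_eq0; apply/orP.
    left; have := sumet; rewrite t0 => /eqP; rewrite psumr_eq0//.
    by move=> /allP/(_ i); rewrite mem_index_enum => /(_ isT).
  by rewrite -scaler_nat scalerA divff ?scale1r// pnatr_eq0.
have fb : t%:R * f b <= p%:R * `|B|.
  apply: le_trans (_ : t%:R * `|B| <= _); last first.
    by rewrite ler_wpM2r// ler_nat.
  have [->|t0] := eqVneq t 0%N; first by rewrite !mul0r.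
  rewrite ler_wpM2l// (le_trans _ (ler_norm _))// /b scaler_sumr.
  under eq_bigr do rewrite scalerA.
  apply: fB => [i|]; first by rewrite mulr_ge0// invr_ge0.
  by rewrite -mulr_sumr sumet mulVf// pnatr_eq0.
have szn : (size (nseq t b) <= p)%N by rewrite size_nseq.
have sumc : (\sum_i c i + size (nseq t b) = 2 ^ K)%N.
  by rewrite size_nseq subnKC.
have := dyadic_combination_bound d0 fmid fa0 szn sumc.
rewrite tb big_nseq iter_addr addr0 -big_split /=.
have -> : (2 ^+ K)^-1 *: (\sum_i (a i *+ c i + e i *: a i)) = \sum_i x i *: a i.
  rewrite scaler_sumr; apply: eq_bigr => i _.
  rewrite -(scaler_nat (c i)) -scalerDl scalerA /e addrC subrK.
  by rewrite mulKf// expf_neq0.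
move=> fz; rewrite lerBlDr (le_trans fz)// lerD//.
  by rewrite -(mulr_natl (f b)) ler_wpM2r// invr_ge0 exprn_ge0.
by rewrite ler_wpM2l// knuth_yao_sum_le.
Qed.

(** * Norms on row vectors and the distance to a set *)

Lemma is_norm0 (R : realType) (n : nat) (N : 'rV[R]_n -> R) :
  is_norm N -> N 0 = 0.
Proof.
by move=> hN; rewrite -(scale0r (0 : 'rV_n)) (is_norm_homog hN) normr0 mul0r.
Qed.

Lemma is_normN (R : realType) (n : nat) (N : 'rV[R]_n -> R) (x : 'rV_n) :
  is_norm N -> N (- x) = N x.
Proof.
by move=> hN; rewrite -scaleN1r (is_norm_homog hN) normrN1 mul1r.
Qed.

Lemma is_norm_ge0 (R : realType) (n : nat) (N : 'rV[R]_n -> R) (x : 'rV_n) :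
  is_norm N -> 0 <= N x.
Proof.
move=> hN; have := is_norm_triangle hN x (- x).
by rewrite subrr (is_norm0 hN) (is_normN _ hN); lra.
Qed.

Lemma is_norm_distC (R : realType) (n : nat) (N : 'rV[R]_n -> R) (x y : 'rV_n) :
  is_norm N -> N (x - y) = N (y - x).
Proof. by move=> hN; rewrite -(is_normN _ hN) opprB. Qed.

Lemma is_norm_sum (R : realType) (n : nat) (N : 'rV[R]_n -> R) (I : finType)
    (v : I -> 'rV_n) :
  is_norm N -> N (\sum_i v i) <= \sum_i N (v i).
Proof.
move=> hN; elim/big_ind2: _ => [|x1 y1 x2 y2 h1 h2|//].
  by rewrite (is_norm0 hN).
by rewrite (le_trans (is_norm_triangle hN _ _))// lerD.
Qed.

Lemma coord_le_norm (R : realType) (m n : nat) (v : 'M[R]_(m, n)) i j :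
  `|v i j| <= `|v|.
Proof.
rewrite [leRHS]/Num.norm /= mx_normrE.
by apply/bigmax_geP; right; exists (i, j).
Qed.

Lemma lipschitz_continuous (R : realType) (m : nat) (f : 'rV[R]_m -> R)
    (M : R) :
  0 <= M -> (forall x y, f x - f y <= M * `|x - y|) -> continuous f.
Proof.
move=> M0 lip x; apply/(@cvgrPdist_lt _ _ _ (nbhs x) (nbhs_filter x)) => e e0.
have r0 : 0 < (M + 1)^-1 * e by rewrite mulr_gt0// invr_gt0 ltr_wpDl.
apply: (@filterS _ _ (nbhs_filter x) _ _ _ (nbhsx_ballx x _ r0)) => y.
rewrite -ball_normE /ball_ /= => xy.
apply: le_lt_trans (_ : M * `|x - y| < _).
  rewrite ler_norml lip andbT lerNl opprB.
  by rewrite (le_trans (lip y x))// distrC.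
apply: le_lt_trans (_ : (M + 1) * `|x - y| < _).
  by rewrite ler_wpM2r// lerDl.
by rewrite -ltr_pdivlMl// ltr_wpDl.
Qed.

Lemma is_norm_combination_le (R : realType) (n m : nat) (N : 'rV[R]_n -> R)
    (a : 'I_m -> 'rV_n) (y : 'rV[R]_m) :
  is_norm N -> N (\sum_i y ord0 i *: a i) <= (\sum_i N (a i)) * `|y|.
Proof.
move=> hN; rewrite (le_trans (is_norm_sum _ hN))//.
rewrite mulr_suml ler_sum// => i _; rewrite (is_norm_homog hN) mulrC.
by rewrite ler_wpM2l ?is_norm_ge0// coord_le_norm.
Qed.

Lemma is_norm_continuous (R : realType) (n : nat) (N : 'rV[R]_n -> R) :
  is_norm N -> continuous N.
Proof.
move=> hN; apply: (@lipschitz_continuous _ _ _ (\sum_(i < n) N (delta_mx 0 i))).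
  by rewrite sumr_ge0// => i _; exact: is_norm_ge0.
move=> x y; apply: le_trans (is_norm_combination_le _ _ hN).
rewrite -row_sum_delta lerBlDr -{1}(subrK y x).
exact: is_norm_triangle.
Qed.

(** The linear form [v |-> v_i] attains its norm on the unit sphere of [N], by
    compactness of the unit sphere of the sup norm.  The maximizer [e] is
    Birkhoff orthogonal to the hyperplane [v_i = 0]. *)
Lemma norming_vector (R : realType) (n : nat) (N : 'rV[R]_n -> R) (i : 'I_n) :
  is_norm N ->
  exists e : 'rV[R]_n,
    [/\ N e = 1, 0 < e ord0 i
      & forall v : 'rV[R]_n, `|v ord0 i| <= e ord0 i * N v].
Proof.
move=> hN; pose S : set 'rV[R]_n := [set v | `|v| = 1].
have N0 (v : 'rV[R]_n) : v != 0 -> 0 < N v.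
  move=> v0; rewrite lt_neqAle is_norm_ge0// andbT eq_sym.
  by apply: contraNneq v0 => /(is_norm_eq0 hN) ->.
have S0 v : S v -> v != 0.
  by move=> Sv; rewrite -normr_eq0 Sv oner_neq0.
have S0' : S !=set0.
  exists (`|delta_mx ord0 i : 'rV[R]_n|^-1 *: delta_mx ord0 i).
  rewrite /S/= normrZ normfV normr_id mulVf// normr_eq0.
  by apply/eqP => /rowP/(_ i)/eqP; rewrite !mxE !eqxx oner_eq0.
have cS : compact S.
  apply: bounded_closed_compact.
    by exists 1; split=> // M M1 v /= ->; exact: ltW.
  have -> : S = (fun v : 'rV[R]_n => `|v|) @^-1` [set 1] by [].
  apply: preimage_closed; last exact: closed_eq.
  by move=> v _; exact: norm_continuous.
pose g (v : 'rV[R]_n) := v ord0 i / N v.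
have cg : {within S, continuous g}.
  apply: continuous_in_subspaceT.
  move=> w /set_mem Sw; apply: (@continuousM _ _ (fun v : 'rV[R]_n => v ord0 i)
    (fun v => (N v)^-1)); first exact: coord_continuous.
  by apply: continuousV; [rewrite gt_eqF// N0// S0|exact: is_norm_continuous].
have [u uS umax] := EVT_max_rV S0' cS cg.
rewrite inE in uS.
have bound (v : 'rV[R]_n) : `|v ord0 i| <= g u * N v.
  have gle (w : 'rV[R]_n) : w != 0 -> g w <= g u.
    move=> w0; have := umax (`|w|^-1 *: w).
    rewrite inE /S /= normrZ normfV normr_id mulVf ?normr_eq0// => /(_ erefl).
    rewrite /g !mxE (is_norm_homog hN) ger0_norm ?invr_ge0// invfM.
    by rewrite mulrACA divff ?mul1r// invr_neq0// normr_eq0.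
  have [->|v0] := eqVneq v 0.
    by rewrite mxE normr0 (is_norm0 hN) mulr0.
  rewrite ler_norml -ler_pdivrMr ?N0// gle// andbT lerNl.
  have := gle (- v); rewrite oppr_eq0 => /(_ v0).
  by rewrite /g mxE (is_normN _ hN) ler_pdivrMr ?N0.
have gu : 0 < g u.
  rewrite ltNge; apply/negP => gu; have := bound (delta_mx ord0 i).
  rewrite mxE !eqxx normr1 => h.
  have := is_norm_ge0 (delta_mx ord0 i) hN.
  by move=> /(ler_wnM2r gu); rewrite mul0r mulrC; lra.
have Nu := N0 _ (S0 _ uS).
exists ((N u)^-1 *: u); rewrite (is_norm_homog hN) mxE.
rewrite ger0_norm ?invr_ge0 ?(ltW Nu)// mulVf ?gt_eqF// mulrC.
by split.
Qed.

Section distance.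
Context (R : realType) (n : nat) (N : 'rV[R]_n -> R) (A : set 'rV[R]_n).
Hypotheses (hN : is_norm N) (A0 : A !=set0).

Let has_inf_dist x : has_inf [set N (x - a) | a in A].
Proof.
split; first by case: A0 => a Aa; exists (N (x - a)); exists a.
by exists 0 => _ [a _ <-]; exact: is_norm_ge0.
Qed.

Lemma dist_le x a : A a -> dist N x A <= N (x - a).
Proof. by move=> Aa; apply: ge_inf; [case: (has_inf_dist x)|exists a]. Qed.

Lemma le_dist x r : (forall a, A a -> r <= N (x - a)) -> r <= dist N x A.
Proof.
move=> h; apply: lb_le_inf; first by case: (has_inf_dist x).
by move=> _ [a Aa <-]; exact: h.
Qed.

Lemma dist_adherent x e : 0 < e -> exists2 a, A a & N (x - a) < dist N x A + e.
Proof.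
move=> e0; have [_ [a Aa <-] h] := inf_adherent e0 (has_inf_dist x).
by exists a.
Qed.

Lemma dist_lipschitz x y : dist N x A <= N (x - y) + dist N y A.
Proof.
rewrite -lerBlDl; apply: le_dist => a Aa.
rewrite lerBlDl (le_trans (dist_le x Aa))//.
by rewrite -(subrKA y) (is_norm_triangle hN).
Qed.

(** Points close to [x] and [y] have a midpoint close to that of [x] and [y],
    so that approximate midconvexity of the set passes to its distance
    function. *)
Lemma dist_midconvex d x y : approx_midconvex N d A ->
  dist N (2^-1 *: (x + y)) A <= (dist N x A + dist N y A) / 2 + d.
Proof.
move=> hA; apply/ler_addgt0Pr => e e0.
have [a Aa ha] := dist_adherent x e0.
have [b Ab hb] := dist_adherent y e0.
apply: le_trans (dist_lipschitz _ (2^-1 *: (a + b))) _.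
have := hA a b Aa Ab.
rewrite -scalerBr opprD addrACA (is_norm_homog hN) ger0_norm ?invr_ge0//.
have := is_norm_triangle hN (x - a) (y - b).
move: ha hb; lra.
Qed.

End distance.

(** * Convex hulls and Caratheodory's theorem *)

Definition is_weight (R : realType) (m : nat) (x : 'I_m -> R) : Prop :=
  (forall i, 0 <= x i) /\ \sum_i x i = 1.

Definition combination_of (R : realType) (n : nat) (A : set 'rV[R]_n) (m : nat)
    (z : 'rV[R]_n) : Prop :=
  exists (a : 'I_m -> 'rV[R]_n) (x : 'I_m -> R),
    [/\ forall i, A (a i), is_weight x & z = \sum_i x i *: a i].

Lemma convex_combination (R : realType) (V : lmodType R)
    (B : set (convex_lmodType V)) :
  convex_set B -> forall (m : nat) (a : 'I_m -> V) (x : 'I_m -> R),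
  (forall i, B (a i)) -> is_weight x -> B (\sum_i x i *: a i).
Proof.
move=> cB; elim=> [|m IH] a x aB [x0].
  by rewrite big_ord0 => /eqP; rewrite eq_sym oner_eq0.
rewrite !big_ord_recl; set s := \sum_(i < m) _ => x1.
have s0 : 0 <= s by rewrite sumr_ge0.
have x0s : x ord0 = 1 - s by rewrite -x1 addrK.
have [s00|sn0] := eqVneq s 0.
  rewrite x0s s00 subr0 scale1r big1 ?addr0// => i _.
  move/eqP: s00; rewrite psumr_eq0// => /allP/(_ i).
  by rewrite mem_index_enum => /(_ isT)/eqP ->; rewrite scale0r.
have s1 : s <= 1 by have := x0 ord0; rewrite x0s subr_ge0.
have h : B (\sum_(i < m) (s^-1 * x (lift ord0 i)) *: a (lift ord0 i)).
  apply: IH => //; split=> [i|]; first by rewrite mulr_ge0// invr_ge0.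
  by rewrite -mulr_sumr mulVf.
have x01 : x ord0 <= 1 by rewrite x0s gerBl.
have /set_mem := cB _ _ (Itv01 (x0 ord0) x01) (mem_set (aB ord0)) (mem_set h).
have -> : \sum_(i < m) x (lift ord0 i) *: a (lift ord0 i) =
    (1 - x ord0) *: \sum_(i < m) (s^-1 * x (lift ord0 i)) *: a (lift ord0 i).
  rewrite x0s opprB addrC subrK scaler_sumr; apply: eq_bigr => i _.
  by rewrite scalerA mulVKf.
by [].
Qed.

Lemma bigmin_index (R : realType) (m : nat) (P : pred 'I_m) (F : 'I_m -> R) i0 :
  P i0 -> exists2 j, P j & forall i, P i -> F j <= F i.
Proof.
by move=> Pi0; case: (@arg_minP _ _ _ i0 P F Pi0) => j Pj h; exists j.
Qed.

(** Moving the weights along an affine dependence [y] keeps the combination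
    fixed.  Stopping when the first weight vanishes removes a point. *)
Lemma caratheodory_step (R : realType) (n m : nat) (A : set 'rV[R]_n)
    (a : 'I_m.+1 -> 'rV[R]_n) (x y : 'I_m.+1 -> R) :
  (forall i, A (a i)) -> is_weight x ->
  \sum_i y i = 0 -> \sum_i y i *: a i = 0 -> (exists i, y i != 0) ->
  combination_of A m (\sum_i x i *: a i).
Proof.
move=> aA [x0 x1] y0 ya0 [k yk].
have [i0 yi0] : exists i, 0 < y i.
  apply: contrapT => h; move: yk; apply/negP; rewrite negbK.
  have yle i : 0 <= - y i.
    by rewrite oppr_ge0 leNgt; apply/negP => yi; apply: h; exists i.
  have : \sum_i - y i == 0 by rewrite sumrN y0 oppr0.
  rewrite psumr_eq0// => /allP/(_ k).
  by rewrite mem_index_enum oppr_eq0; apply.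
(* [j] is the index of the weight that vanishes first, at the time [t]. *)
have [j yj jmin] :=
  @bigmin_index _ _ (fun i => 0 < y i) (fun i => x i / y i) _ yi0.
pose t := x j / y j; pose x' i := x i - t * y i.
have t0 : 0 <= t by rewrite divr_ge0// ltW.
have x'0 i : 0 <= x' i.
  rewrite subr_ge0; have [yi|yi] := ltP 0 (y i); last first.
    by rewrite (le_trans _ (x0 i))// mulr_ge0_le0.
  by rewrite -ler_pdivlMr// jmin.
have x'j : x' j = 0 by rewrite /x' /t divfK ?subrr// gt_eqF.
exists (fun i => a (lift j i)), (fun i => x' (lift j i)); split => //.
  split=> //; have <- : \sum_i x' i = 1.
    by rewrite sumrB -mulr_sumr y0 mulr0 subr0.
  by rewrite (bigD1_ord j)//= x'j add0r.
have -> : \sum_i x i *: a i = \sum_i x' i *: a i.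
  under [RHS]eq_bigr do rewrite scalerBl -scalerA.
  by rewrite sumrB -scaler_sumr ya0 scaler0 subr0.
by rewrite (bigD1_ord j)//= x'j scale0r add0r.
Qed.

(** Prefixing each point with 1 turns affine dependence of the points into
    linear dependence of the rows. *)
Definition affine_matrix (R : realType) (n m : nat) (a : 'I_m -> 'rV[R]_n) :
    'M[R]_(m, 1 + n) :=
  row_mx (const_mx 1) (\matrix_i a i).

Lemma mul_affine_matrix (R : realType) (n m : nat) (a : 'I_m -> 'rV[R]_n)
    (y : 'rV[R]_m) :
  y *m affine_matrix a = row_mx (\sum_i y 0 i)%:M (\sum_i y 0 i *: a i).
Proof.
rewrite mul_mx_row; congr row_mx.
  apply/rowP => i; rewrite !mxE ord1 eqxx mulr1n.
  by apply: eq_bigr => k _; rewrite mxE mulr1.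
by rewrite mulmx_sum_row; apply: eq_bigr => i _; rewrite rowK.
Qed.

Lemma affine_dependence (R : realType) (n m : nat) (a : 'I_m -> 'rV[R]_n) :
  ~~ row_free (affine_matrix a) ->
  exists y : 'I_m -> R,
    [/\ \sum_i y i = 0, \sum_i y i *: a i = 0 & exists i, y i != 0].
Proof.
rewrite -kermx_eq0 => /rowV0Pn[y /sub_kermxP].
rewrite mul_affine_matrix -row_mx0 => /eq_row_mx[/rowP/(_ 0) y0 ya0] yn0.
exists (y 0); split=> //; first by move: y0; rewrite !mxE eqxx mulr1n.
apply/existsP; apply: contraNT yn0; rewrite negb_exists => /forallP h.
by apply/eqP/rowP => i; rewrite mxE; apply/eqP; have := h i; rewrite negbK.
Qed.

(** For [n+1] affinely independent points the weights move freely in all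
    directions of space: this is what makes a point with positive weights an
    interior point of the simplex. *)
Lemma affine_span (R : realType) (n : nat) (a : 'I_n.+1 -> 'rV[R]_n) :
  row_free (affine_matrix a) -> forall v : 'rV[R]_n,
  exists y : 'I_n.+1 -> R, \sum_i y i = 0 /\ \sum_i y i *: a i = v.
Proof.
move=> fa v; have ua : affine_matrix a \in unitmx by rewrite -row_free_unit.
pose y : 'rV[R]_n.+1 := row_mx (0 : 'rV_1) v *m invmx (affine_matrix a).
have : y *m affine_matrix a = row_mx (0 : 'rV_1) v by rewrite mulmxKV.
rewrite mul_affine_matrix => /eq_row_mx[/rowP/(_ 0) y0 ya].
by exists (y 0); split=> //; move: y0; rewrite !mxE eqxx mulr1n.
Qed.

Lemma combination_ofS (R : realType) (n : nat) (A : set 'rV[R]_n) (m : nat) z :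
  combination_of A m z -> combination_of A m.+1 z.
Proof.
move=> [a [x [aA [x0 x1] ->]]].
have [i0 _] : exists i0 : 'I_m, true.
  case: m a x aA x0 x1 => [|m] a x _ _; last by move=> _; exists ord0.
  by rewrite big_ord0 => /eqP; rewrite eq_sym oner_eq0.
exists (fun i => if unlift ord0 i is Some k then a k else a i0),
  (fun i => if unlift ord0 i is Some k then x k else 0); split.
- by move=> i; case: unlift.
- split=> [i|]; first by case: unlift.
  by rewrite big_ord_recl unlift_none add0r; under eq_bigr do rewrite liftK.
- rewrite big_ord_recl unlift_none scale0r add0r.
  by under [RHS]eq_bigr do rewrite liftK.
Qed.

Lemma combination_of_leq (R : realType) (n : nat) (A : set 'rV[R]_n) (m k : nat)
    z :
  (m <= k)%N -> combination_of A m z -> combination_of A k z.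
Proof.
move=> /subnK <- h; elim: (k - m)%N => // j; rewrite addSn.
exact: combination_ofS.
Qed.

Lemma caratheodory (R : realType) (n : nat) (A : set 'rV[R]_n) z :
  convex_hull A z -> combination_of A n.+1 z.
Proof.
move=> hz; have [m] : exists m, combination_of A m z.
  move: z hz; apply: smallest_sub; last first.
    move=> a Aa; exists 1, (fun=> a), (fun=> 1); split=> //.
      by split=> //; rewrite big_ord1.
    by rewrite big_ord1 scale1r.
  move=> _ _ l /set_mem[m1 [a1 [x1 [aA1 [x10 x11] ->]]]]
    /set_mem[m2 [a2 [x2 [aA2 [x20 x21] ->]]]].
  apply/mem_set; exists (m1 + m2)%N.
  exists (fun i : 'I_(m1 + m2) => match fintype.split i with
    inl j => a1 j | inr j => a2 j end).
  exists (fun i : 'I_(m1 + m2) => match fintype.split i with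
    inl j => l%:num * x1 j | inr j => (1 - l%:num) * x2 j end).
  have spl i : fintype.split (lshift m2 i : 'I_(m1 + m2)) = inl i :=
    unsplitK (inl i).
  have spr i : fintype.split (rshift m1 i : 'I_(m1 + m2)) = inr i :=
    unsplitK (inr i).
  split.
  - by move=> i; case: fintype.split.
  - split=> [i|].
      by case: fintype.split => j; rewrite mulr_ge0// subr_ge0.
    rewrite big_split_ord/=; under eq_bigr do rewrite spl.
    under [X in _ + X]eq_bigr do rewrite spr.
    by rewrite -!mulr_sumr x11 x21 !mulr1 addrC subrK.
  - rewrite big_split_ord/=.
    under [X in _ = X + _]eq_bigr do rewrite spl -scalerA.
    under [X in _ = _ + X]eq_bigr do rewrite spr -scalerA.
    by rewrite -!scaler_sumr.
elim: m => [|m IH]; first exact: combination_of_leq.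
have [mn|mn] := leqP m n; first exact: combination_of_leq.
move=> [a [x [aA wx zE]]]; apply: IH; rewrite zE.
have /affine_dependence[y [y0 ya0 yn0]] : ~~ row_free (affine_matrix a).
  by rewrite -row_leq_rank -ltnNge (leq_ltn_trans (rank_leq_col _)).
exact: caratheodory_step y0 ya0 yn0.
Qed.

(** * Nearly orthogonal vectors *)

Definition dot (R : realType) (n : nat) (u v : 'rV[R]_n) : R :=
  \sum_i u ord0 i * v ord0 i.

Lemma dotC (R : realType) (n : nat) (u v : 'rV[R]_n) : dot u v = dot v u.
Proof. by apply: eq_bigr => i _; rewrite mulrC. Qed.

Lemma dotDl (R : realType) (n : nat) (u v w : 'rV[R]_n) :
  dot (u + v) w = dot u w + dot v w.
Proof. by rewrite -big_split; apply: eq_bigr => i _; rewrite mxE mulrDl. Qed.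

Lemma dotZl (R : realType) (n : nat) k (u v : 'rV[R]_n) :
  dot (k *: u) v = k * dot u v.
Proof. by rewrite mulr_sumr; apply: eq_bigr => i _; rewrite mxE mulrA. Qed.

Lemma dotNl (R : realType) (n : nat) (u v : 'rV[R]_n) : dot (- u) v = - dot u v.
Proof. by rewrite -scaleN1r dotZl mulN1r. Qed.

Lemma dotNr (R : realType) (n : nat) (u v : 'rV[R]_n) : dot u (- v) = - dot u v.
Proof. by rewrite dotC dotNl dotC. Qed.

Lemma dotZr (R : realType) (n : nat) k (u v : 'rV[R]_n) :
  dot u (k *: v) = k * dot u v.
Proof. by rewrite dotC dotZl dotC. Qed.

Lemma dot_suml (R : realType) (n m : nat) (u : 'I_m -> 'rV[R]_n) (v : 'rV_n) :
  dot (\sum_i u i) v = \sum_i dot (u i) v.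
Proof.
have d0 : dot 0 v = 0 by rewrite /dot big1// => i _; rewrite mxE mul0r.
by apply: (big_morph (fun u => dot u v)) => // x y; rewrite dotDl.
Qed.

Lemma dot_sqrD (R : realType) (n : nat) (u v : 'rV[R]_n) :
  dot (u + v) (u + v) = dot u u + 2 * dot u v + dot v v.
Proof. by rewrite dotDl ![dot _ (u + v)]dotC !dotDl (dotC v u); ring. Qed.

Lemma euclidean_normE (R : realType) (n : nat) (N : 'rV[R]_n -> R) :
  (forall x, N x = euclidean_norm x) -> forall x, N x ^+ 2 = dot x x.
Proof.
move=> hE x; rewrite hE /euclidean_norm sqr_sqrtr ?sumr_ge0//.
by move=> i _; exact: sqr_ge0.
Qed.

(** The Gram matrix of the vectors would be strictly diagonally dominant, hence
    invertible, whereas [n+1] vectors of [R^n] are linearly dependent.  The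
    contradiction is read off the row of the largest coefficient of a
    dependence. *)
Lemma almost_orthogonal_absurd (R : realType) (n : nat) (r2 : R)
    (u : 'I_n.+1 -> 'rV[R]_n) :
  (forall i, r2 <= dot (u i) (u i)) ->
  (forall i j, i != j -> n%:R * `|dot (u i) (u j)| < r2) -> (0 < n)%N -> False.
Proof.
move=> ur uo n0.
have : ~~ row_free (\matrix_i u i).
  by rewrite -row_leq_rank -ltnNge ltnS rank_leq_col.
rewrite -kermx_eq0 => /rowV0Pn[y /sub_kermxP].
rewrite mulmx_sum_row; under eq_bigr do rewrite rowK; move=> yu yn0.
have [i imax] : exists i, forall k, `|y 0 k| <= `|y 0 i|.
  by case: (@arg_maxP _ _ _ ord0 predT (fun k => `|y 0 k|) isT) => i _ h;
    exists i => k; exact: h.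
have yi0 : 0 < `|y 0 i|.
  rewrite lt_neqAle normr_ge0 andbT eq_sym; apply: contraNneq yn0 => yi.
  apply/eqP/rowP => k; rewrite mxE; apply/eqP.
  by rewrite -normr_le0 -yi imax.
have : dot (\sum_k y 0 k *: u k) (u i) = 0.
  by rewrite yu /dot big1// => k _; rewrite mxE mul0r.
rewrite dot_suml; under eq_bigr do rewrite dotZl.
rewrite (bigD1_ord i)//= => /eqP; rewrite addr_eq0 => /eqP.
move=> /(congr1 (fun t => n%:R * `|t|)); rewrite normrM normrN => e.
suff : n%:R * (`|y 0 i| * `|dot (u i) (u i)|) < n%:R * (`|y 0 i| * r2).
  rewrite ltr_pM2l ?ltr0n// ltr_pM2l// ltNge => /negP; apply.
  by rewrite (le_trans (ur i))// ler_norm.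
rewrite e; apply: le_lt_trans (_ : \sum_(k < n) `|y 0 i| *
    (n%:R * `|dot (u (lift i k)) (u i)|) < _).
  rewrite -mulr_sumr -mulr_sumr mulrCA ler_wpM2l//.
  rewrite mulr_sumr (le_trans (ler_norm_sum _ _ _))// ler_sum// => k _.
  by rewrite normrM ler_wpM2r// imax.
rewrite -mulr_sumr mulrCA ltr_pM2l//.
have -> : n%:R * r2 = \sum_(k < n) r2 by rewrite sumr_const card_ord mulr_natl.
apply: ltr_sum => [|k _]; last by apply: uo; rewrite eq_sym neq_lift.
by apply/hasP; exists (Ordinal n0); rewrite ?mem_index_enum.
Qed.

(** Each new vector is chosen against the sum of the previous ones.  Since no
    scalar product is below [-c], a scalar product above [(n-1)c] would make the
    total positive. *)
Lemma greedy_almost_orthogonal (R : realType) (n : nat) (P : set 'rV[R]_n)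
    (c r2 : R) :
  (2 <= n)%N -> 0 <= c -> n%:R * (n.-1%:R * c) < r2 ->
  (forall v, exists2 w, P w & dot v w <= 0) ->
  (forall u v, P u -> P v -> - c <= dot u v) ->
  forall m, (m <= n.+1)%N -> exists u : nat -> 'rV[R]_n,
    (forall i, (i < m)%N -> P (u i)) /\
    (forall i j, (i < j < m)%N -> n%:R * `|dot (u i) (u j)| < r2).
Proof.
move=> n2 c0 cr Pv Pd; elim=> [|m IH] mn.
  by exists (fun=> 0); split=> // i j; rewrite ltn0 andbF.
have [u [uP uo]] := IH (ltnW mn).
have [w Pw] := Pv (\sum_(i < m) u i); rewrite dot_suml => dw.
exists (fun i => if i == m then w else u i); split=> [i|i j].
  by case: eqP => // im; rewrite ltnS leq_eqVlt => /orP[/eqP//|]; exact: uP.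
move=> /andP[ij jm]; have im : (i < m)%N by lia.
rewrite (ltn_eqF im); case: eqP => [_|jnm]; last by apply: uo; lia.
apply: le_lt_trans cr; rewrite ler_wpM2l// ler_norml.
have n1 : 1 <= n.-1%:R :> R by rewrite ler1n; lia.
have cn : c <= n.-1%:R * c by rewrite ler_peMl.
apply/andP; split.
  by apply: le_trans (Pd _ _ (uP _ im) Pw); rewrite lerN2.
case: m im {IH uo jm} mn uP dw => // m im mn uP.
rewrite (bigD1_ord (Ordinal im))//= => dw.
have : - (m%:R * c) <= \sum_(k < m) dot (u (lift (Ordinal im) k)) w.
  have -> : - (m%:R * c) = \sum_(k < m) - c.
    by rewrite sumr_const card_ord mulr_natl mulNrn.
  by apply: ler_sum => k _; apply: Pd => //; apply: uP.
have : m%:R * c <= n.-1%:R * c by rewrite ler_wpM2r// ler_nat; lia.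
by move: dw; lra.
Qed.

(** This chooses how little more than the least distance [r] a near point may
    have. *)
Lemma small_square (R : realType) (r g h : R) : 0 <= r -> 0 < g -> 0 < h ->
  exists e, [/\ 0 < e, e <= h & (r + e) ^+ 2 <= r ^+ 2 + g].
Proof.
move=> r0 g0 h0; pose q := g / (2 * r + 1).
have r1 : 0 < 2 * r + 1 by lra.
exists (Num.min h (Num.min 1 q)); set e := Num.min _ _.
have e0 : 0 < e by rewrite !lt_min h0 ltr01 divr_gt0.
have e1 : e <= 1 by rewrite !ge_min lexx orbT.
have eq : e <= q by rewrite !ge_min lexx !orbT.
split=> //; first by rewrite ge_min lexx.
have : e * (2 * r + 1) <= g by rewrite -ler_pdivlMr.
by nra.
Qed.

Lemma log_bound1 (R : realType) : log_bound R 1 = 2.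
Proof. by rewrite log_boundE// trunc_log1 expr0 divr1. Qed.

Lemma log_bound2 (R : realType) : log_bound R 2 = 3.
Proof. by rewrite log_boundE// trunc_lognn// expr1 divff// natr1. Qed.

Lemma log_bound_ge3 (R : realType) (k : nat) : (3 <= k)%N ->
  7 / 2 <= log_bound R k.
Proof.
rewrite leq_eqVlt => /orP[/eqP <-|k4].
  rewrite log_boundE// (@trunc_log_eq 2 1 3)// expr1; lra.
have k0 : (0 < k)%N by lia.
have L2 : (2 <= trunc_log 2 k)%N by apply: trunc_log_max.
rewrite log_boundE//.
have : 1 <= k%:R / 2 ^+ trunc_log 2 k :> R.
  by rewrite ler_pdivlMr ?exprn_gt0// mul1r -natrX ler_nat trunc_logP.
have : 3 <= (trunc_log 2 k).+1%:R :> R by rewrite ler_nat.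
lra.
Qed.

(** The numerical heart of the Euclidean case: if [r > d * kappa(n-1)], then the
    bound [c] on the obtuseness of two near points is small enough for the
    greedy choice.  The values [kappa(1) = 2] and [kappa(2) = 3] settle [n = 2]
    (where the equilateral triangle makes the inequality sharp) and [n = 3]; for
    [n >= 4] the bound [kappa >= 7/2 > 2 + sqrt 2] makes all angles acute. *)
Lemma obtuse_room (R : realType) (n : nat) (d r : R) :
  (2 <= n)%N -> 0 <= d -> d * log_bound R n.-1 < r ->
  exists c tau, [/\ 0 <= c, 0 < tau, n%:R * (n.-1%:R * c) < r ^+ 2
    & (r + tau) ^+ 2 - 2 * (r - d) ^+ 2 <= c].
Proof.
move=> n2 d0 dr; pose D := r ^+ 2 - 2 * (r - d) ^+ 2.
pose M : R := n%:R * n.-1%:R.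
have M0 : 0 < M by rewrite mulr_gt0// ltr0n; lia.
have r0 : 0 < r.
  apply: le_lt_trans dr; rewrite mulr_ge0//.
  apply: le_trans (knuth_yao_sum_le R 0 _); last by lia.
  by rewrite /knuth_yao_sum big_ord0.
have MD : M * D < r ^+ 2.
  move: n2; rewrite leq_eqVlt => /orP[/eqP n2|].
    move: dr; rewrite /M /D -n2 /= log_bound1 mulr1 => dr.
    by nra.
  rewrite leq_eqVlt => /orP[/eqP n3|n4].
    move: dr; rewrite /M /D -n3 /= log_bound2 => dr.
    by nra.
  have : 7 / 2 <= log_bound R n.-1 by apply: log_bound_ge3; lia.
  move=> /(ler_wpM2l d0) k7.
  have D0 : D < 0 by rewrite /D; nra.
  by rewrite (@lt_trans _ _ 0)// ?exprn_gt0// pmulr_rlt0.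
(* Adding [g] to [D] uses up half of the gap between [M * D] and [r ^+ 2]. *)
pose g := (r ^+ 2 - M * D) / (2 * M).
have gM : M * g = (r ^+ 2 - M * D) / 2 by rewrite /g; field; rewrite gt_eqF.
have g0 : 0 < g by rewrite divr_gt0 ?subr_gt0// mulr_gt0.
have [tau [tau0 _ htau]] := small_square (ltW r0) g0 ltr01.
exists (Num.max 0 (D + g)), tau; split=> //.
- by rewrite le_max lexx.
- rewrite mulrA -/M /Num.max; case: ifP => _; last by rewrite mulr0 exprn_gt0.
  by rewrite mulrDr gM; move: MD; lra.
- by rewrite le_max; apply/orP; right; rewrite /D; move: htau; lra.
Qed.

(** * Upper bounds for the distance to the hull *)

Section hull_distance.
Context (R : realType) (n : nat) (N : 'rV[R]_n -> R) (A : set 'rV[R]_n).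
Context (d : R).
Hypotheses (hN : is_norm N) (A0 : A !=set0).
Hypotheses (d0 : 0 <= d) (hA : approx_midconvex N d A).

Lemma combination_dist_le (p : nat) z : (0 < p)%N -> combination_of A p.+1 z ->
  dist N z A <= d * log_bound R p.
Proof.
move=> p0 [a [x [aA [x0 x1] ->]]].
apply: (hull_bound (f := fun z => dist N z A)
  (B := \sum_i N (a i - a ord0))) => //.
- by move=> y z'; exact: dist_midconvex.
- by move=> i; rewrite (le_trans (dist_le hN A0 _ (aA i)))// subrr is_norm0.
move=> y y0 y1; rewrite (le_trans (dist_le hN A0 _ (aA ord0)))//.
have -> : \sum_i y i *: a i - a ord0 = \sum_i y i *: (a i - a ord0).
  under [RHS]eq_bigr do rewrite scalerBr.
  by rewrite sumrB -scaler_suml y1 scale1r.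
rewrite (le_trans (is_norm_sum _ hN))// ler_sum// => i _.
rewrite (is_norm_homog hN) ger0_norm// ler_piMl ?is_norm_ge0//.
by rewrite -y1 (bigD1 i)//= lerDl sumr_ge0.
Qed.

Hypothesis hE : forall x, N x = euclidean_norm x.

(** If moving from [z] in the direction [v] does not increase the distance to
    [A], then some almost nearest point of [A] lies ahead.  Indeed a point [a]
    with [|z + tv - a| <= r + e] and [|z - a| >= r] satisfies
    [2t v.(a - z) >= t^2 |v|^2 - O(e)]. *)
Lemma nearest_points_surround z v (t0 : R) : 0 < t0 ->
  (forall t, 0 < t -> t <= t0 -> dist N (z + t *: v) A <= dist N z A) ->
  forall tau, 0 < tau ->
  exists2 a, A a & 0 <= dot v (a - z) /\ N (a - z) < dist N z A + tau.
Proof.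
move=> t00 zmax tau tau0; set r := dist N z A in zmax *.
have r0 : 0 <= r by apply: le_dist => // a _; exact: is_norm_ge0.
have [v0|v0] := eqVneq v 0.
  have [a Aa ha] := dist_adherent hN A0 z tau0; exists a => //.
  split; last by rewrite is_norm_distC.
  by rewrite v0 /dot big1// => i _; rewrite mxE mul0r.
have Nv : 0 < N v.
  rewrite lt_neqAle is_norm_ge0// andbT eq_sym.
  by apply: contraNneq v0 => /(is_norm_eq0 hN) ->.
pose t := Num.min t0 (tau / (2 * N v)).
have t_gt0 : 0 < t by rewrite lt_min t00 divr_gt0// mulr_gt0.
have tNv : t * N v <= tau / 2.
  rewrite -ler_pdivlMr// -mulrA -invfM /t ge_min.
  by rewrite mulrC lexx orbT.
have g0 : 0 < (t * N v) ^+ 2 by rewrite exprn_gt0// mulr_gt0.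
have tau2 : 0 < tau / 2 by rewrite divr_gt0.
have [e [e0 etau er]] := small_square r0 g0 tau2.
have [a Aa] := dist_adherent hN A0 (z + t *: v) e0.
have tt0 : t <= t0 by rewrite ge_min lexx.
move=> /lt_le_trans/(_ (lerD (zmax t t_gt0 tt0) (lexx e))) ha.
exists a => //; pose u := a - z.
have Nu : N (u + - (t *: v)) < r + e.
  by rewrite (is_norm_distC _ _ hN) opprB addrCA addrA.
have ru : r <= N u by rewrite (is_norm_distC _ _ hN) dist_le.
rewrite -/u; split.
  have : N (u + - (t *: v)) ^+ 2 <= (r + e) ^+ 2.
    by rewrite ler_sqr ?nnegrE ?is_norm_ge0 ?addr_ge0// ltW.
  have : r ^+ 2 <= N u ^+ 2 by rewrite ler_sqr ?nnegrE ?is_norm_ge0.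
  rewrite !(euclidean_normE hE) dot_sqrD.
  rewrite dotNl !dotNr opprK dotZl !dotZr (dotC u).
  move: er; rewrite exprMn (euclidean_normE hE) => er h1 h2.
  have : 0 <= t * dot v u by move: er h1 h2; lra.
  by rewrite pmulr_rge0.
have := is_norm_triangle hN (u + - (t *: v)) (t *: v).
rewrite subrK (is_norm_homog hN) ger0_norm ?(ltW t_gt0)//.
move: Nu tNv etau; lra.
Qed.

(** The midpoint of [a] and [b] is within [d] of [A], hence at distance at least
    [r - d] from [z]; expanding the square of the norm of the sum turns this
    into a lower bound for the scalar product. *)
Lemma near_points_not_obtuse z tau a b : 0 <= tau -> d <= dist N z A ->
  A a -> A b -> N (a - z) < dist N z A + tau -> N (b - z) < dist N z A + tau ->
  2 * (dist N z A - d) ^+ 2 - (dist N z A + tau) ^+ 2 <= dot (a - z) (b - z).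
Proof.
set r := dist N z A => tau0 rd Aa Ab ha hb.
have h : r - d <= N (2^-1 *: ((a - z) + (b - z))).
  have := dist_lipschitz hN A0 z (2^-1 *: (a + b)).
  have := hA Aa Ab; rewrite -/r is_norm_distC//.
  have -> : 2^-1 *: (a + b) - z = 2^-1 *: (a - z + (b - z)).
    rewrite addrACA -opprD scalerBr; congr (_ - _).
    by rewrite -mulr2n -(scaler_nat 2 z) scalerA mulVf ?scale1r// pnatr_eq0.
  lra.
have : (r - d) ^+ 2 <= N (2^-1 *: ((a - z) + (b - z))) ^+ 2.
  by rewrite ler_sqr ?nnegrE ?is_norm_ge0 ?subr_ge0.
have : N (a - z) ^+ 2 <= (r + tau) ^+ 2.
  rewrite ler_sqr ?nnegrE ?is_norm_ge0 ?(ltW ha)//.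
  by rewrite (le_trans _ (ltW ha))// is_norm_ge0.
have : N (b - z) ^+ 2 <= (r + tau) ^+ 2.
  rewrite ler_sqr ?nnegrE ?is_norm_ge0 ?(ltW hb)//.
  by rewrite (le_trans _ (ltW hb))// is_norm_ge0.
rewrite (is_norm_homog hN) ger0_norm ?invr_ge0// exprMn.
rewrite !(euclidean_normE hE) (dot_sqrD (a - z)).
rewrite (_ : 2^-1 ^+ 2 = 4^-1 :> R); last by field.
move=> hbb haa hab; lra.
Qed.

(** At a local maximum some near point lies ahead in each direction, while no two
    near points form too obtuse an angle.  Together these feed the greedy choice
    of [n+1] nearly orthogonal vectors. *)
Lemma local_max_dist_le z : (2 <= n)%N ->
  (forall v, exists2 t0 : R, 0 < t0 & forall t, 0 < t -> t <= t0 ->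
    dist N (z + t *: v) A <= dist N z A) ->
  dist N z A <= d * log_bound R n.-1.
Proof.
move=> n2 zmax; rewrite leNgt; apply/negP => gap.
have [c [tau [c0 tau0 cr hc]]] := obtuse_room n2 d0 gap.
set r := dist N z A in zmax gap cr hc *.
have rd : d <= r.
  apply: le_trans (ltW gap); rewrite ler_peMr//.
  apply: le_trans (knuth_yao_sum_le R 1 _); last by lia.
  rewrite /knuth_yao_sum big_ord1 expn0 expr0 divr1.
  by rewrite (minn_idPl _)//; lia.
pose P : set 'rV[R]_n :=
  [set u | exists2 a, A a & u = a - z /\ N (a - z) < r + tau].
have Pv v : exists2 w, P w & dot v w <= 0.
  have [t0 t00 ht] := zmax (- v).
  have [a Aa [av ha]] := nearest_points_surround t00 ht tau0.
  exists (a - z); first by exists a.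
  by move: av; rewrite dotNl oppr_ge0.
have Pd u v : P u -> P v -> - c <= dot u v.
  move=> [a Aa [-> ha]] [b Ab [-> hb]].
  apply: le_trans (near_points_not_obtuse (ltW tau0) rd Aa Ab ha hb).
  by move: hc; rewrite -/r; lra.
have [u [uP uo]] := greedy_almost_orthogonal n2 c0 cr Pv Pd (leqnn n.+1).
apply: (@almost_orthogonal_absurd R n (r ^+ 2) (fun i => u i)); last by lia.
  move=> i; have [a Aa [-> _]] := uP i (ltn_ord i).
  rewrite -(euclidean_normE hE) ler_sqr ?nnegrE ?is_norm_ge0//.
    by rewrite (is_norm_distC _ _ hN) dist_le.
  by rewrite (le_trans d0).
move=> i j; rewrite neq_ltn => /orP[ij|ij]; first by apply: uo; rewrite ij/=.
by rewrite dotC; apply: uo; rewrite ij/=.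
Qed.

(** The maximum of the distance over the simplex of weights is attained.  At a
    maximum where a weight vanishes, or for affinely dependent points, [n]
    points suffice; otherwise the maximum is an interior point of the simplex,
    hence a local maximum. *)
Lemma euclidean_combination_dist_le z : (2 <= n)%N ->
  combination_of A n.+1 z -> dist N z A <= d * log_bound R n.-1.
Proof.
move=> n2 [a [x [aA [x0 x1] ->]]].
have npts w : combination_of A n w -> dist N w A <= d * log_bound R n.-1.
  move=> hw; apply: combination_dist_le; first by lia.
  by rewrite prednK//; lia.
pose S : set 'rV[R]_n.+1 :=
  [set y | (forall i, 0 <= y ord0 i) /\ \sum_i y ord0 i = 1].
pose h (y : 'rV[R]_n.+1) := \sum_i y ord0 i *: a i.
have S0 : S (\row_i x i).
  split=> [i|]; first by rewrite mxE.
  by under eq_bigr do rewrite mxE.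
have cS : compact S.
  apply: bounded_closed_compact.
    exists 1; split=> // M M1 y [y0 y1].
    rewrite /Num.norm /= mx_normrE; apply/bigmax_leP.
    split=> [|[i j] _]; first by rewrite ltW// (lt_trans _ M1).
    rewrite ord1 /= ger0_norm// (le_trans _ (ltW M1))// -y1 (bigD1 j)//=.
    by rewrite lerDl sumr_ge0.
  have -> : S = (\bigcap_i [set y : 'rV[R]_n.+1 | 0 <= y ord0 i]) `&`
      [set y | \sum_i y ord0 i = 1].
    by apply/seteqP; split=> y [y0 y1]; split=> // i; [move=> _|]; exact: y0.
  apply: closedI.
    apply: closed_bigI => i _.
    have -> : [set y : 'rV[R]_n.+1 | 0 <= y ord0 i] =
      (fun y : 'rV[R]_n.+1 => y ord0 i) @^-1` [set t | 0 <= t] by [].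
    apply: preimage_closed; last exact: closed_ge.
    by move=> y _; exact: coord_continuous.
  suff csum : continuous (fun y : 'rV[R]_n.+1 => \sum_i y ord0 i : R).
    have : closed ((fun y : 'rV[R]_n.+1 => \sum_i y ord0 i : R) @^-1` [set 1]).
      by apply: preimage_closed; [move=> y _; exact: csum|exact: closed_eq].
    by [].
  apply: (@lipschitz_continuous _ _ _ n.+1%:R) => // y y'; rewrite -sumrB.
  have -> : n.+1%:R * `|y - y'| = \sum_(i < n.+1) `|y - y'|.
    by rewrite sumr_const card_ord mulr_natl.
  apply: ler_sum => i _; apply: le_trans (coord_le_norm _ ord0 i).
  by rewrite !mxE ler_norm.
pose f y := dist N (h y) A.
have cf : {within S, continuous f}.
  apply: continuous_subspaceT.
  apply: (@lipschitz_continuous _ _ _ (\sum_i N (a i))).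
    by rewrite sumr_ge0// => i _; exact: is_norm_ge0.
  move=> y y'; apply: le_trans (is_norm_combination_le _ _ hN).
  rewrite lerBlDr (le_trans (dist_lipschitz hN A0 (h y) (h y')))//.
  rewrite lerD2r -sumrB; under [in leRHS]eq_bigr do rewrite !mxE scalerBl.
  exact: lexx.
have [y yS ymax] := EVT_max_rV (ex_intro _ _ S0) cS cf.
have {yS}[y0 y1] := set_mem yS.
have hx : h (\row_i x i) = \sum_i x i *: a i.
  by apply: eq_bigr => i _; rewrite mxE.
rewrite -hx; apply: le_trans (ymax _ (mem_set S0)) _; rewrite /f.
have wy : is_weight (y ord0) by [].
have [fa|/affine_dependence[w [w0 wa wn0]]] :=
  boolP (row_free (affine_matrix a)); last first.
  by apply: npts; exact: caratheodory_step wn0.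
have [[i yi]|ypos] := pselect (exists i, y ord0 i = 0).
  apply: npts; exists (fun k => a (lift i k)), (fun k => y ord0 (lift i k)).
  split=> //; last by rewrite /h (bigD1_ord i)//= yi scale0r add0r.
  by split=> //; rewrite -y1 (bigD1_ord i)//= yi add0r.
apply: local_max_dist_le => // v.
have [w [w0 wv]] := affine_span fa v.
have [j _ jmin] := @bigmin_index _ _ predT (fun i => y ord0 i) ord0 isT.
have yj : 0 < y ord0 j.
  by rewrite lt_neqAle y0 andbT eq_sym; apply/eqP => yj; apply: ypos; exists j.
(* Steps shorter than [y_j / W] keep all the weights nonnegative. *)
pose W := 1 + \sum_i `|w i|.
have W0 : 0 < W by rewrite ltr_pwDl// sumr_ge0.
exists (y ord0 j / W); first by rewrite divr_gt0.
move=> t t0 tle.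
have -> : h y + t *: v = h (\row_i (y ord0 i + t * w i)).
  rewrite -wv scaler_sumr -big_split/=; apply: eq_bigr => i _.
  by rewrite mxE scalerDl scalerA.
apply: ymax; apply/mem_set; split=> [i|].
  rewrite mxE; have : - (t * w i) <= y ord0 j.
    rewrite (le_trans (ler_norm _))// normrN normrM ger0_norm ?(ltW t0)//.
    move: tle; rewrite ler_pdivlMr//; apply: le_trans.
    rewrite ler_wpM2l ?(ltW t0)// /W (bigD1 i)//= addrCA lerDl.
    by rewrite addr_ge0// sumr_ge0.
  by have := jmin i isT; lra.
under eq_bigr do rewrite mxE; rewrite big_split/= y1 -mulr_sumr w0.
by rewrite mulr0 addr0.
Qed.

End hull_distance.

(** * The cost of Knuth-Yao trees *)

Definition frac (R : realType) (x : R) : R := x - (Num.floor x)%:~R.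

Lemma frac_ge0 (R : realType) (x : R) : 0 <= frac x.
Proof. by rewrite subr_ge0 floor_le. Qed.

Lemma frac_le (R : realType) (x : R) : 0 <= x -> frac x <= x.
Proof. by move=> x0; rewrite gerBl ler0z floor_ge0. Qed.

Lemma frac_nat (R : realType) (m : nat) : frac (m%:R : R) = 0.
Proof. by rewrite /frac pmulrn intrKfloor subrr. Qed.

Lemma fracD (R : realType) (x y : R) : frac (x + y) <= frac x + frac y.
Proof.
rewrite addrACA -opprD lerD2l lerN2 -intrD ler_int floor_ge_int intrD.
by rewrite lerD// floor_le.
Qed.

(** [frac (2^k x)] counts the inner nodes at level [k] spent on a leaf of weight
    [x].  For [0 <= x < 1] this tends to [sum_j j b_j 2^-j] as [K] grows, where
    the [b_j] are the binary digits of [x]. *)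
Definition knuth_yao_cost (R : realType) (K : nat) (x : R) : R :=
  \sum_(k < K) frac (2 ^+ k * x) / 2 ^+ k.

Lemma knuth_yao_costS (R : realType) (K : nat) (x : R) :
  knuth_yao_cost K.+1 x = frac x + knuth_yao_cost K (2 * x) / 2.
Proof.
rewrite /knuth_yao_cost big_ord_recl /= expr0 mul1r divr1; congr (_ + _).
rewrite mulr_suml; apply: eq_bigr => i _.
by rewrite /bump /= add1n exprSr -mulrA invfM [LHS]mulrA.
Qed.

Lemma knuth_yao_costD (R : realType) (K : nat) (x y : R) :
  knuth_yao_cost K (x + y) <= knuth_yao_cost K x + knuth_yao_cost K y.
Proof.
rewrite -big_split/= ler_sum// => k _.
by rewrite -mulrDl ler_wpM2r ?invr_ge0 ?exprn_ge0// mulrDr fracD.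
Qed.

Lemma knuth_yao_cost_leS (R : realType) (K : nat) (x : R) :
  knuth_yao_cost K x <= knuth_yao_cost K.+1 x.
Proof.
rewrite /knuth_yao_cost big_ord_recr/= lerDl.
by rewrite divr_ge0 ?frac_ge0// exprn_ge0.
Qed.

(** A tree for the midpoint is obtained by joining the trees for [x] and [y]
    under a new root; the last term is the share of the root in the cost. *)
Lemma knuth_yao_cost_mid (R : realType) (K : nat) (x y : R) :
  0 <= x -> 0 <= y ->
  knuth_yao_cost K ((x + y) / 2) <=
  (knuth_yao_cost K x + knuth_yao_cost K y) / 2 + (x + y) / 2.
Proof.
move=> x0 y0; have xy0 : 0 <= (x + y) / 2 by rewrite divr_ge0// addr_ge0.
case: K => [|K]; first by rewrite /knuth_yao_cost !big_ord0 addr0 mul0r add0r.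
rewrite knuth_yao_costS [2 * _]mulrC divfK//.
have := frac_le xy0.
have := knuth_yao_costD K x y.
have := knuth_yao_cost_leS K x.
have := knuth_yao_cost_leS K y.
lra.
Qed.

Lemma knuth_yao_cost_nat (R : realType) (K m : nat) :
  knuth_yao_cost K (m%:R : R) = 0.
Proof.
by rewrite /knuth_yao_cost big1// => k _; rewrite -natrX -natrM frac_nat mul0r.
Qed.

(** The unit mass is split into [p] parts, each of [d i] units of size
    [2^-(L+1)], where [2^L <= p < 2^(L+1)]: the extremal weights lie just below
    these dyadic values, which gives them long binary expansions. *)
Lemma half_double_split (p : nat) : (0 < p)%N ->
  exists d : 'I_p -> nat, (forall i, (0 < d i <= 2)%N) /\
    (\sum_i d i = 2 ^ (trunc_log 2 p).+1)%N.
Proof.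
move=> p0; have /andP[lo hi] := trunc_log_bounds (isT : (1 < 2)%N) p0.
set L := trunc_log 2 p in lo hi *.
have qp : (2 ^ L.+1 - p <= p)%N.
  by rewrite leq_subLR addnn -mul2n expnS leq_mul2l.
exists (fun i => 1 + (i < 2 ^ L.+1 - p))%N.
split=> [i|]; first by case: (i < _)%N.
rewrite big_split /= sum1_card card_ord -big_mkcond /=.
by rewrite (big_ord_narrow qp) sum1_card card_ord subnKC// ltnW.
Qed.

(** There are [2^k - sum_i floor (2^k x_i)] inner nodes at level [k].  For
    [k <= L] all the floors are nonpositive.  For [k > L] the number
    [2^k d_i/2^(L+1)] is an integer, so the strict upper bound on [x_i] costs
    one unit in each of the [p] floors. *)
Lemma knuth_yao_cost_lower (R : realType) (p K : nat) (d : 'I_p -> nat)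
    (x : 'I_p.+1 -> R) :
  (0 < p)%N -> (forall i, (0 < d i <= 2)%N) ->
  (\sum_i d i = 2 ^ (trunc_log 2 p).+1)%N ->
  \sum_i x i = 1 -> x ord0 < (2 ^+ K)^-1 ->
  (forall i, x (lift ord0 i) < (d i)%:R / 2 ^+ (trunc_log 2 p).+1) ->
  knuth_yao_sum R p K <= \sum_i knuth_yao_cost K (x i).
Proof.
move=> p0 d12 sumd x1 xK xd; set L := trunc_log 2 p in sumd xd.
rewrite exchange_big /= ler_sum// => k _.
rewrite -mulr_suml ler_wpM2r ?invr_ge0 ?exprn_ge0// sumrB -mulr_sumr x1 mulr1.
rewrite lerBrDr -lerBrDl -mulrz_sumr.
have pow0 j : 0 < 2 ^+ j :> R by rewrite exprn_gt0.
have fl0 : Num.floor (2 ^+ k * x ord0) <= 0.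
  rewrite floor_le0 -ltr_pdivlMl// mulr1 (lt_le_trans xK)// lef_pV2 ?posrE//.
  by rewrite ler_weXn2l// ?ler1n// ltnW.
have [kL|Lk] := leqP k L.
  apply: le_trans (_ : 0 <= _); last first.
    by rewrite subr_ge0 -natrX ler_nat geq_minl.
  rewrite lerz0 big_ord_recl /=.
  suff : \sum_(i < p) Num.floor (2 ^+ k * x (lift ord0 i)) <= 0.
    by move=> /(lerD fl0); rewrite addr0.
  apply: sumr_le0 => i _; rewrite floor_le0 -ltr_pdivlMl// mulr1.
  apply: lt_le_trans (xd i) _; rewrite ler_pdivrMr// exprS.
  have /andP[_ di2] := d12 i.
  apply: le_trans (_ : 2 <= _); first by rewrite ler_nat.
  rewrite mulrCA ler_peMr// mulrC ler_pdivlMr// mul1r.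
  by rewrite ler_weXn2l// ler1n.
apply: le_trans (_ : 2 ^+ k - p%:R <= _); last first.
  by rewrite lerD2l lerN2 ler_nat geq_minr.
have -> : 2 ^+ k - p%:R =
    (\sum_(i < p) ((2 ^ (k - L.+1) * d i)%:Z - 1))%:~R :> R.
  rewrite sumrB sumr_const card_ord intrB -mulr_natl mulr1 natz -pmulrn.
  congr (_ - _); rewrite -(big_morph Posz PoszD (erefl 0%:Z)).
  by rewrite -pmulrn -big_distrr /= sumd -expnD subnK// natrX.
rewrite ler_int big_ord_recl /= -[leRHS]add0r lerD// ler_sum// => i _.
rewrite -ltzD1 subrK floor_lt_int -pmulrn natrM natrX.
rewrite -ltr_pdivlMl//; apply: lt_le_trans (xd i) _.
have -> : 2 ^+ k = 2 ^+ (k - L.+1) * 2 ^+ L.+1 :> R by rewrite -exprD subnK.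
by rewrite invfM [leRHS]mulrC mulrACA divff ?expf_neq0// mul1r.
Qed.

(** * Sets with a large stability constant *)

(** Coordinates adapted to the norm: a height [h] of norm 1 attained at [e], and
    coordinates [c] along the basis [w] of the hyperplane [h = 0]. *)
Lemma flat_chart (R : realType) (p : nat) (N : 'rV[R]_p.+1 -> R) :
  is_norm N ->
  exists (h : 'rV[R]_p.+1 -> R) (c : 'I_p -> 'rV[R]_p.+1 -> R)
      (e : 'rV[R]_p.+1) (w : 'I_p -> 'rV[R]_p.+1) (M : R),
    [/\ scalar h /\ (forall i, scalar (c i)),
        (forall v, `|h v| <= N v) /\ (forall i v, `|c i v| <= M * N v),
        [/\ N e = 1, h e = 1 & forall i, c i e = 0],
        0 <= M
      & (forall i, h (w i) = 0) /\ (forall i j, c j (w i) = (i == j)%:R)].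
Proof.
move=> hN; have /choice[E hE] := fun i => norming_vector i hN.
have [Ne e0 eN] := hE ord0; set e := E ord0 in Ne e0 eN.
pose M := \sum_i E i ord0 i.
have E0 i : 0 <= E i ord0 i by have [_ /ltW] := hE i.
have M0 : 0 <= M by rewrite sumr_ge0.
have coordM (v : 'rV[R]_p.+1) i : `|v ord0 i| <= M * N v.
  have [_ _ /(_ v) h] := hE i; rewrite (le_trans h)//.
  rewrite ler_wpM2r ?is_norm_ge0// /M (bigD1 i)//= lerDl.
  by rewrite sumr_ge0// => j _.
pose h (v : 'rV[R]_p.+1) := v ord0 ord0 / e ord0 ord0.
have hN1 v : `|h v| <= N v.
  by rewrite normrM normfV (gtr0_norm e0) ler_pdivrMr// mulrC.
exists h,
  (fun i (v : 'rV[R]_p.+1) => v ord0 (lift ord0 i) - h v * e ord0 (lift ord0 i)),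
  e,
  (fun i => delta_mx ord0 (lift ord0 i)), (M + M); split.
- split=> [k u v|i k u v]; first by rewrite /h !mxE; field; rewrite gt_eqF.
  by rewrite /h !mxE; field; rewrite gt_eqF.
- split=> // i v; rewrite (le_trans (ler_normB _ _))// mulrDl lerD//.
  rewrite normrM mulrC; apply: ler_pM => //.
  by rewrite (le_trans (coordM _ _))// Ne mulr1.
- have he : h e = 1 by rewrite /h divff// gt_eqF.
  by split=> // i; rewrite he mul1r subrr.
- by rewrite addr_ge0.
- have hw i : h (delta_mx ord0 (lift ord0 i)) = 0.
    by rewrite /h mxE eqxx/= mul0r.
  split=> // i j; rewrite hw mul0r subr0 mxE eqxx/=.
  by rewrite (inj_eq lift_inj) eq_sym.
Qed.

(** The vertex with index [ord0] is the origin of the chart. *)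
Definition barycentric (R : realType) (p : nat) (y : 'I_p -> R) :
    'I_p.+1 -> R :=
  fun i => if unlift ord0 i is Some j then y j else 1 - \sum_j y j.

Lemma barycentric0 (R : realType) (p : nat) (y : 'I_p -> R) :
  barycentric y ord0 = 1 - \sum_j y j.
Proof. by rewrite /barycentric unlift_none. Qed.

Lemma barycentricS (R : realType) (p : nat) (y : 'I_p -> R) j :
  barycentric y (lift ord0 j) = y j.
Proof. by rewrite /barycentric liftK. Qed.

Lemma barycentric_sum (R : realType) (p : nat) (y : 'I_p -> R) :
  \sum_i barycentric y i = 1.
Proof.
rewrite big_ord_recl barycentric0 (eq_bigr _ (fun j _ => barycentricS y j)).
by rewrite subrK.
Qed.

Lemma barycentric_mid (R : realType) (p : nat) (y y' y'' : 'I_p -> R) i :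
  (forall j, y'' j = (y j + y' j) / 2) ->
  barycentric y'' i = (barycentric y i + barycentric y' i) / 2.
Proof.
move=> h; rewrite /barycentric; case: unlift => [j|]; first exact: h.
by rewrite (eq_bigr _ (fun j _ => h j)) -mulr_suml big_split/=; field.
Qed.

Section epigraph.
Context (R : realType) (p K : nat) (N : 'rV[R]_p.+1 -> R).
Context (h : 'rV[R]_p.+1 -> R) (c : 'I_p -> 'rV[R]_p.+1 -> R).
Context (e : 'rV[R]_p.+1) (w : 'I_p -> 'rV[R]_p.+1) (M s : R).
Hypotheses (hN : is_norm N) (lin_h : scalar h) (lin_c : forall i, scalar (c i)).
Hypotheses (h_le : forall v, `|h v| <= N v).
Hypotheses (c_le : forall i v, `|c i v| <= M * N v).
Hypotheses (Ne : N e = 1) (he : h e = 1) (ce : forall i, c i e = 0).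
Hypotheses (hw : forall i, h (w i) = 0).
Hypotheses (cw : forall i j, c j (w i) = (i == j)%:R).
Hypotheses (s0 : 0 < s) (M0 : 0 <= M).

Definition weights_at (v : 'rV[R]_p.+1) : 'I_p.+1 -> R :=
  barycentric (fun j => c j v / s).

Definition cost_at (v : 'rV[R]_p.+1) : R :=
  \sum_i knuth_yao_cost K (weights_at v i).

Definition cost_epigraph : set 'rV[R]_p.+1 :=
  [set v | (forall i, 0 <= weights_at v i) /\ cost_at v <= h v].

Let scalar0 f : scalar f -> f (0 : 'rV[R]_p.+1) = 0 :> R.
Proof.
by move=> lf; have := lf (-1) 0 0; rewrite scaler0 addr0 mulN1r addNr.
Qed.

Let scalarZ f k v : scalar f -> f (k *: v : 'rV[R]_p.+1) = k * f v :> R.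
Proof. by move=> lf; rewrite -[k *: v]addr0 lf scalar0// addr0. Qed.

Let scalarD f u v : scalar f -> f (u + v : 'rV[R]_p.+1) = f u + f v :> R.
Proof. by move=> lf; rewrite -[u]scale1r lf mul1r scale1r. Qed.

Let scalarB f u v : scalar f -> f (u - v : 'rV[R]_p.+1) = f u - f v :> R.
Proof. by move=> lf; rewrite scalarD// -scaleN1r scalarZ// mulN1r. Qed.

Let scalar_sum f (m : nat) (u : 'I_m -> 'rV[R]_p.+1) :
  scalar f -> f (\sum_i u i) = \sum_i f (u i) :> R.
Proof.
move=> lf; apply: (big_morph f); last exact: scalar0.
by move=> x y; rewrite scalarD.
Qed.

Lemma cost_epigraph_vertex (i : 'I_p.+1) :
  cost_epigraph (if unlift ord0 i is Some j then s *: w j else 0).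
Proof.
set v := (X in cost_epigraph X).
have wv k : weights_at v k = (k == i)%:R.
  rewrite /weights_at /v; case: (unliftP ord0 i) => [j|] ->; last first.
    have z j : c j 0 / s = 0 by rewrite scalar0// mul0r.
    case: (unliftP ord0 k) => [l|] ->; first by rewrite barycentricS z.
    by rewrite barycentric0 big1// subr0.
  have z l : c l (s *: w j) / s = (j == l)%:R.
    by rewrite scalarZ// cw mulrAC divff ?mul1r// gt_eqF.
  case: (unliftP ord0 k) => [l|] ->.
    by rewrite barycentricS z (inj_eq lift_inj) eq_sym.
  rewrite barycentric0 (bigD1 j)//= z eqxx big1 => [|l lj].
    by rewrite addr0 subrr.
  by rewrite z eq_sym (negPf lj).
split=> [k|]; first by rewrite wv.
rewrite /cost_at big1 => [|k _]; last by rewrite wv knuth_yao_cost_nat.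
by rewrite /v; case: unlift => [j|]; rewrite ?scalarZ// ?hw ?mulr0// scalar0.
Qed.

Lemma cost_epigraph_nonempty : cost_epigraph !=set0.
Proof.
exists (if unlift ord0 ord0 is Some j then s *: w j else 0).
exact: cost_epigraph_vertex.
Qed.

(** The midpoint lies at most 1 below the epigraph, because the cost is
    approximately midconvex; lifting it along [e] reaches the epigraph. *)
Lemma cost_epigraph_approx_midconvex : approx_midconvex N 1 cost_epigraph.
Proof.
move=> a0 a1 [a00 ha0] [a10 ha1]; set m := 2^-1 *: (a0 + a1).
have wm i : weights_at m i = (weights_at a0 i + weights_at a1 i) / 2.
  apply: barycentric_mid => j.
  by rewrite /m scalarZ// scalarD//; field; rewrite gt_eqF.
have hm : h m = (h a0 + h a1) / 2 by rewrite /m scalarZ// scalarD// mulrC.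
have gm : cost_at m <= h m + 1.
  have w1 : \sum_i (weights_at a0 i + weights_at a1 i) / 2 = 1.
    by rewrite -mulr_suml big_split/= !barycentric_sum; field.
  have : cost_at m <= (cost_at a0 + cost_at a1) / 2 +
      \sum_i (weights_at a0 i + weights_at a1 i) / 2.
    rewrite /cost_at -big_split mulr_suml -big_split /=.
    by apply: ler_sum => i _; rewrite wm; exact: knuth_yao_cost_mid.
  by rewrite w1 hm; move: ha0 ha1; lra.
pose t := Num.max 0 (cost_at m - h m).
have t0 : 0 <= t by rewrite le_max lexx.
have t1 : t <= 1 by rewrite ge_max ler01/=; move: gm; lra.
pose b := m + t *: e.
have wb i : weights_at b i = weights_at m i.
  rewrite /weights_at; congr (barycentric _ i); apply/funext => j.
  rewrite /b (scalarD m _ (lin_c j)) (scalarZ t e (lin_c j)).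
  by rewrite ce mulr0 addr0.
have Ab : cost_epigraph b.
  split=> [i|]; first by rewrite wb wm divr_ge0// addr_ge0.
  rewrite /cost_at (eq_bigr _ (fun i _ => congr1 _ (wb i))) -/(cost_at m).
  rewrite /b (scalarD m _ lin_h) (scalarZ t e lin_h) he mulr1 addrC -lerBlDr.
  by rewrite le_max lexx orbT.
apply: le_trans (dist_le hN cost_epigraph_nonempty m Ab) _.
rewrite /b opprD addrA subrr add0r (is_normN _ hN) (is_norm_homog hN) Ne mulr1.
by rewrite ger0_norm.
Qed.

(** The witness [z] is the base point with the extremal weights lowered by
    [eta].
    A point [a] of the epigraph is either at distance at least
    [s * eta / M] from [z], by one of its coordinates [c j], or it lies above
    the region of high cost, and its height bounds its distance to [z]. *)
Lemma stability_constant_ge (d : 'I_p -> nat) (eta C : R) :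
  (0 < p)%N -> (forall i, (0 < d i <= 2)%N) ->
  (\sum_i d i = 2 ^ (trunc_log 2 p).+1)%N ->
  0 < eta -> eta <= (2 ^+ (trunc_log 2 p).+1)^-1 ->
  p%:R * eta <= (2 ^+ K)^-1 / 2 ->
  M * knuth_yao_sum R p K < s * eta ->
  stability_constants N C -> knuth_yao_sum R p K <= C.
Proof.
move=> p0 d12 sumd eta0 etaL etaK sM hC.
set L := trunc_log 2 p in sumd etaL.
pose y (i : 'I_p) : R := (d i)%:R / 2 ^+ L.+1 - eta.
pose z := \sum_i y i *: (s *: w i).
have cz j : c j z = s * y j.
  rewrite scalar_sum// (bigD1 j)//= big1 => [|i ij].
    by rewrite !scalarZ// cw eqxx mulr1 addr0 mulrC.
  by rewrite !scalarZ// cw (negPf ij) !mulr0.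
have hz : h z = 0.
  by rewrite scalar_sum// big1// => i _; rewrite !scalarZ// hw !mulr0.
have y0 i : 0 <= y i.
  rewrite subr_ge0 (le_trans etaL)// ler_peMl ?invr_ge0 ?exprn_ge0// ler1n.
  by have /andP[] := d12 i.
have sumy : \sum_i y i = 1 - p%:R * eta.
  rewrite sumrB -mulr_suml -natr_sum sumd natrX divff ?expf_neq0//.
  by rewrite sumr_const card_ord mulr_natl.
have hull_z : convex_hull cost_epigraph z.
  move=> B [cB AB].
  have -> : z = \sum_i barycentric y i *:
      (if unlift ord0 i is Some j then s *: w j else 0).
    rewrite big_ord_recl unlift_none scaler0 add0r.
    by apply: eq_bigr => i _; rewrite barycentricS liftK.
  apply: convex_combination => // [i|].
    exact: AB (cost_epigraph_vertex i).
  split; last exact: barycentric_sum.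
  move=> i; case: (unliftP ord0 i) => [j|] ->; first by rewrite barycentricS.
  by rewrite barycentric0 sumy opprB addrC subrK mulr_ge0// ltW.
have := hC 1 cost_epigraph ler01 cost_epigraph_nonempty
  cost_epigraph_approx_midconvex z hull_z.
rewrite mulr1; apply: le_trans; apply: le_dist => //.
  exact: cost_epigraph_nonempty.
move=> a [a0 ha].
have far j : eta <= `|c j a / s - y j| -> knuth_yao_sum R p K <= N (z - a).
  move=> hj; rewrite leNgt; apply/negP => Nlt.
  have : s * eta <= M * N (z - a).
    apply: le_trans (c_le j _); rewrite scalarB// cz distrC.
    have -> : c j a - s * y j = s * (c j a / s - y j).
      by field; rewrite gt_eqF.
    by rewrite normrM (gtr0_norm s0) ler_pM2l.
  apply/negP; rewrite -ltNge; apply: le_lt_trans sM.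
  by rewrite ler_wpM2l// ltW.
have [[j hj]|near] := pselect (exists j, eta <= `|c j a / s - y j|).
  exact: far hj.
have nearj j : `|c j a / s - y j| < eta.
  by rewrite ltNge; apply/negP => hj; apply: near; exists j.
apply: le_trans (h_le _); rewrite scalarB// hz sub0r normrN.
apply: le_trans (ler_norm _); apply: le_trans ha.
apply: (knuth_yao_cost_lower p0 d12 sumd (barycentric_sum _)); last first.
  move=> i; rewrite /weights_at barycentricS -/L.
  have := nearj i; rewrite /y ltr_norml => /andP[_]; lra.
rewrite /weights_at barycentric0.
have far_sum : 1 - \sum_j c j a / s < p%:R * eta + p%:R * eta.
  rewrite -ltrBlDr addrAC -sumy -sumrB.
  have -> : p%:R * eta = \sum_(j < p) eta.
    by rewrite sumr_const card_ord mulr_natl.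
  apply: ltr_sum => [|j _].
    by apply/hasP; exists (Ordinal p0); rewrite ?mem_index_enum.
  by have := nearj j; rewrite distrC; apply: le_lt_trans; exact: ler_norm.
by apply: lt_le_trans far_sum _; move: etaK; lra.
Qed.

End epigraph.

(** * The smallest stability constant *)

(** The partial sums up to level [K], realized by the epigraphs of the truncated
    costs, tend to the bound. *)
Lemma log_bound_le_constant (R : realType) (p : nat) (N : 'rV[R]_p.+1 -> R)
    (C : R) :
  (0 < p)%N -> is_norm N -> stability_constants N C -> log_bound R p <= C.
Proof.
move=> p0 hN hC; apply/ler_addgt0Pr => eps eps0.
have [K hK] := log_bound_approx p0 eps0.
suff : knuth_yao_sum R p K <= C by move: hK; lra.
have [h [c [e [w [M [[lh lc] [hle cle] [Ne he ce] M0 [hw cw]]]]]]] :=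
  flat_chart hN.
have [d [d12 sumd]] := half_double_split p0.
set L := trunc_log 2 p in sumd.
have pow0 j : 0 < (2 ^+ j : R)^-1 by rewrite invr_gt0 exprn_gt0.
have pR : 0 < p%:R :> R by rewrite ltr0n.
pose eta := Num.min (2 ^+ L.+1)^-1 ((2 ^+ K)^-1 / 2 / p%:R) : R.
have eta0 : 0 < eta by rewrite lt_min pow0 !divr_gt0.
have etaL : eta <= (2 ^+ L.+1)^-1 by rewrite ge_min lexx.
have etaK : p%:R * eta <= (2 ^+ K)^-1 / 2.
  by rewrite mulrC -ler_pdivlMr// ge_min lexx orbT.
have S0 : 0 <= knuth_yao_sum R p K.
  by rewrite sumr_ge0// => k _; rewrite divr_ge0// exprn_ge0.
(* The simplex is scaled so that [s * eta / M] exceeds the partial sum. *)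
pose s := (M * knuth_yao_sum R p K + 1) / eta.
have s0 : 0 < s by rewrite divr_gt0// ltr_wpDl// mulr_ge0.
have sM : M * knuth_yao_sum R p K < s * eta.
  by rewrite divfK ?gt_eqF// ltrDl.
exact: (stability_constant_ge hN lh lc hle cle Ne he ce hw cw s0 M0
  p0 d12 sumd eta0 etaL etaK sM hC).
Qed.

(** Each defining condition is a closed half line of constants when [delta > 0],
    so the infimum satisfies it; for [delta = 0] it does not involve the
    constant. *)
Lemma smallest_stability_constant (R : realType) (n : nat)
    (N : 'rV[R]_n -> R) (b : R) :
  stability_constants N !=set0 -> lbound (stability_constants N) b ->
  is_smallest (stability_constants N) (inf (stability_constants N)).
Proof.
move=> E0 lb; have hinf : has_inf (stability_constants N).
  by split=> //; exists b.
split; last by move=> C hC; apply: ge_inf => //; case: hinf.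
move=> d A d0 A0 hA z hz; have [d_eq0|dn0] := eqVneq d 0.
  have [C hC] := E0; have := hC d A d0 A0 hA z hz.
  by rewrite d_eq0 !mulr0.
have {dn0}d_gt0 : 0 < d by rewrite lt_neqAle eq_sym dn0.
rewrite -ler_pdivrMr//; apply: lb_le_inf => // C hC.
by rewrite ler_pdivrMr//; exact: hC hz.
Qed.

Theorem theorem1 (R : realType) (n : nat) (N : 'rV[R]_n -> R)
    (hn : (2 <= n)%N) (hN : is_norm N) :
  exists C : R,
    [/\ is_smallest (stability_constants N) C,
        log_bound R n.-1 <= C,
        C <= log_bound R n
      & (forall x, N x = euclidean_norm x) -> C = log_bound R n.-1].
Proof.
have n0 : (0 < n)%N by lia.
have n1 : (0 < n.-1)%N by lia.
have upper : stability_constants N (log_bound R n).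
  move=> d A d0 A0 hA z /caratheodory hz.
  by rewrite mulrC; exact: combination_dist_le hz.
have lower : lbound (stability_constants N) (log_bound R n.-1).
  case: n N hN n1 {hn n0 upper} => // p N hN p0 C.
  exact: log_bound_le_constant.
exists (inf (stability_constants N)).
have E0 : stability_constants N !=set0 by exists (log_bound R n).
have sm := smallest_stability_constant E0 lower.
have [hC hlb] := sm; split=> //; first exact: lower.
  exact: hlb.
move=> hE; apply/eqP; rewrite eq_le lower// andbT; apply: hlb.
move=> d A d0 A0 hA z /caratheodory hz.
by rewrite mulrC; exact: euclidean_combination_dist_le hz.
Qed.
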